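(* Let $A_{S_3}$ be the set of all small Schröder paths of order $n\ge 1$, and let $R_{A_{S_3}}(x,y,z)=1+\sum_{P\in A_{S_3}}x^{\mathrm{order}(P)}y^{\mathrm{dr}(P)}z^{\mathrm{hr}(P)}$. Then $$R_{A_{S_3}}(x,y,z)=\frac{1}{2}+\frac{-1+zx+(1-z)x^2+(1-xz)\sqrt{1-2(1+w)u+(1-w)^2u^2}}{2(y^2z-2y+1)x^2-2y^2x-2x},$$ where $$u=x\left(\frac{x+y(1-xz)}{1-xz}\right)^2\quad\text{and}\quad w=\left(\frac{1-xz+x}{x+y(1-xz)}\right)^2.$$
   Context: Let $S_3=\{(1,1),(1,-1),(2,0)\}$; the steps $U=(1,1)$, $D=(1,-1)$, $H=(2,0)$ are called up, down and horizontal steps. For $n\ge 1$, $L_{S_3}(n)$ is the set of lattice paths from $(0,0)$ to $(2n,0)$ with steps in $S_3$ that never go below the $x$-axis (Schröder paths of order $n$); $A_{S_3}(n)\subseteq L_{S_3}(n)$ is the subset of paths having no horizontal steps on the $x$-axis (small Schröder paths of order $n$), and $A_{S_3}=\bigcup_{n\ge 1}A_{S_3}(n)$. For a path $P\in L_{S_3}(n)$, $\mathrm{order}(P)=n$. A run of $P$ is a vertex between two consecutive steps of the same kind; it is diagonal if it joins two consecutive up steps or two consecutive down steps, and horizontal if it joins two consecutive horizontal steps. $\mathrm{dr}(P)$ and $\mathrm{hr}(P)$ denote the numbers of diagonal runs and of horizontal runs of $P$. Identities are between formal power series in $x$ (with coefficients in $\mathbb{Q}(y,z)$), and the square root is the one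 with constant term $1$ in $x$. *)

(* Defs.v *)
From HB Require Import structures.
From mathcomp Require Import all_boot all_order all_algebra.
From mathcomp Require Import boolp.
From mathcomp Require Import mpoly.

Set Implicit Arguments.
Unset Strict Implicit.
Unset Printing Implicit Defensive.

Import Order.TTheory GRing.Theory Num.Theory.
Local Open Scope ring_scope.

(* Formal power series in one variable over a field. [f n] is the coefficient *)
(* of x^n. They form an integral domain, so that quotients whose denominator  *)
(* has no constant term live in [{fraction fps K}], the field of formal       *)
(* Laurent series.                                                            *)

Record fps (K : fieldType) := FPS { fps_coef :> nat -> K }.

HB.instance Definition _ (K : fieldType) := [isNew for @fps_coef K].
HB.instance Definition _ (K : fieldType) := [Choice of fps K by <:].

Section Fps.
Variable K : fieldType.
Implicit Types f g h s a : fps K.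

Lemma fpsP f g : (forall n, f n = g n) <-> f = g.
Proof.
by split=> [e | -> //]; case: f g e => [f] [g] /= e; congr FPS; apply/funext.
Qed.

Definition fpsC (c : K) : fps K := FPS (fun n => if n == 0%N then c else 0).
Definition fpsX : fps K := FPS (fun n => (n == 1%N)%:R).
Definition fps_add f g : fps K := FPS (fun n => f n + g n).
Definition fps_opp f : fps K := FPS (fun n => - f n).
Definition fps_mul f g : fps K :=
  FPS (fun n => \sum_(i < n.+1) f i * g (n - i)%N).

Lemma fps_addA : associative fps_add.
Proof. by move=> f g h; apply/fpsP => n /=; rewrite addrA. Qed.
Lemma fps_addC : commutative fps_add.
Proof. by move=> f g; apply/fpsP => n /=; rewrite addrC. Qed.
Lemma fps_add0 : left_id (fpsC 0) fps_add.
Proof. by move=> f; apply/fpsP => n /=; rewrite if_same add0r. Qed.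
Lemma fps_addN : left_inverse (fpsC 0) fps_opp fps_add.
Proof. by move=> f; apply/fpsP => n /=; rewrite if_same addNr. Qed.

HB.instance Definition _ :=
  GRing.isZmodule.Build (fps K) fps_addA fps_addC fps_add0 fps_addN.

Let trunc N f : {poly K} := \poly_(i < N) f i.

Let fps_mulE N f g n : (n < N)%N ->
  fps_mul f g n = (trunc N f * trunc N g)`_n.
Proof.
move=> ltnN; rewrite coefM /=; apply: eq_bigr => i _.
rewrite !coef_poly (leq_ltn_trans _ ltnN) ?(leq_ltn_trans _ ltnN) //.
  exact: leq_subr.
by rewrite -ltnS.
Qed.

Lemma fps_mulC : commutative fps_mul.
Proof. by move=> f g; apply/fpsP=> n; rewrite !(@fps_mulE n.+1) // mulrC. Qed.

Lemma fps_mulA : associative fps_mul.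
Proof.
move=> f g h; apply/fpsP => n.
have low (p q r : {poly K}) : (forall i, (i < n.+1)%N -> p`_i = q`_i) ->
  (r * p)`_n = (r * q)`_n.
  move=> epq; rewrite !coefM; apply: eq_bigr => i _.
  by rewrite epq // ltnS leq_subr.
have tr f1 f2 i : (i < n.+1)%N ->
    (trunc n.+1 (fps_mul f1 f2))`_i = (trunc n.+1 f1 * trunc n.+1 f2)`_i.
  by move=> lti; rewrite coef_poly lti -fps_mulE.
rewrite [LHS](@fps_mulE n.+1) // [RHS](@fps_mulE n.+1) //.
rewrite (low _ _ _ (tr g h)) [trunc _ (fps_mul f g) * _]mulrC (low _ _ _ (tr f g)).
by rewrite mulrA mulrC.
Qed.

Lemma fps_mul1 : left_id (fpsC 1) fps_mul.
Proof.
move=> f; apply/fpsP => n /=.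
rewrite big_ord_recl /= mul1r subn0 big1 ?addr0 // => i _.
by rewrite mul0r.
Qed.

Lemma fps_mulD : left_distributive fps_mul fps_add.
Proof.
move=> f g h; apply/fpsP => n /=.
by rewrite -big_split; apply: eq_bigr => i _; rewrite mulrDl.
Qed.

Lemma fps_1neq0 : fpsC 1 != 0.
Proof. by apply/eqP => /fpsP/(_ 0%N)/eqP; rewrite oner_eq0. Qed.

HB.instance Definition _ := GRing.Zmodule_isComNzRing.Build (fps K)
  fps_mulA fps_mulC fps_mul1 fps_mulD fps_1neq0.

Lemma fps0E n : (0 : fps K) n = 0.
Proof. by rewrite /= if_same. Qed.
Lemma fps1E n : (1 : fps K) n = (n == 0%N)%:R.
Proof. by case: n. Qed.
Lemma fpsDE f g n : (f + g) n = f n + g n.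
Proof. by []. Qed.
Lemma fpsNE f n : (- f) n = - f n.
Proof. by []. Qed.
Lemma fpsME f g n : (f * g) n = \sum_(i < n.+1) f i * g (n - i)%N.
Proof. by []. Qed.
Lemma fpsM0 f g : (f * g) 0%N = f 0%N * g 0%N.
Proof. by rewrite fpsME big_ord1. Qed.

Fact fpsC_is_zmod_morphism : zmod_morphism fpsC.
Proof. by move=> a b; apply/fpsP => -[|n] //=; rewrite subr0. Qed.
Fact fpsC_is_monoid_morphism : monoid_morphism fpsC.
Proof.
split=> // a b; apply/fpsP => -[|n]; first by rewrite fpsM0.
by rewrite fpsME big_ord_recl /= mulr0 big1 ?addr0 // => i _; rewrite mul0r.
Qed.
HB.instance Definition _ :=
  GRing.isZmodMorphism.Build K (fps K) fpsC fpsC_is_zmod_morphism.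
HB.instance Definition _ :=
  GRing.isMonoidMorphism.Build K (fps K) fpsC fpsC_is_monoid_morphism.

(* The series whose n-th coefficient is [F] of the list of the previous ones. *)
Section Rec.
Variable F : seq K -> K.
Definition fps_prefix n : seq K := iter n (fun t => rcons t (F t)) [::].
Definition fps_rec : fps K := FPS (fun n => F (fps_prefix n)).

Lemma size_fps_prefix n : size (fps_prefix n) = n.
Proof. by elim: n => //= n IHn; rewrite size_rcons IHn. Qed.

Lemma nth_fps_prefix n i : (i < n)%N -> (fps_prefix n)`_i = fps_rec i.
Proof.
elim: n => // n IHn; rewrite ltnS nth_rcons size_fps_prefix leq_eqVlt.
by case: ltngtP => //= [lti _ | -> _]; first exact: IHn.
Qed.
End Rec.

Definition fps_unit : pred (fps K) := fun f => f 0%N != 0.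

Definition fps_inv_step f (t : seq K) : K :=
  if size t is n.+1 then - (\sum_(i < n.+1) f (n.+1 - i)%N * t`_i) / f 0%N
  else (f 0%N)^-1.
Definition fps_inv f : fps K :=
  if f 0%N == 0 then f else fps_rec (fps_inv_step f).

Lemma fps_inv_recS f n (r := fps_rec (fps_inv_step f)) :
  r n.+1 = - (\sum_(i < n.+1) f (n.+1 - i)%N * r i) / f 0%N.
Proof.
rewrite -[LHS]/(fps_inv_step f (fps_prefix _ n.+1)) {1}/fps_inv_step.
rewrite size_fps_prefix; congr (- _ / _).
by apply: eq_bigr => i _; rewrite nth_fps_prefix.
Qed.

Lemma fps_mulV : {in fps_unit, left_inverse 1 fps_inv *%R}.
Proof.
move=> f; rewrite unfold_in => f0; rewrite /fps_inv (negPf f0).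
have g0 : fps_rec (fps_inv_step f) 0%N = (f 0%N)^-1 by [].
move: (fps_rec _) g0 (fps_inv_recS f) => g g0 gS.
apply/fpsP => -[|n]; first by rewrite fpsM0 g0 mulVf.
rewrite fpsME big_ord_recr /= subnn gS.
rewrite -[_ / _ * _]mulrA mulVf // mulr1; apply/eqP; rewrite subr_eq0; apply/eqP.
by apply: eq_bigr => i _; rewrite mulrC.
Qed.

Lemma fps_unitPl f g : g * f = 1 -> fps_unit f.
Proof.
move/fpsP/(_ 0%N)/eqP; rewrite fpsM0 /= => e; apply: contraTneq e => ->.
by rewrite mulr0 eq_sym oner_eq0.
Qed.

Lemma fps_inv_out : {in [predC fps_unit], fps_inv =1 id}.
Proof. by move=> f; rewrite inE unfold_in negbK /fps_inv => ->. Qed.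

HB.instance Definition _ := GRing.ComNzRing_hasMulInverse.Build (fps K)
  fps_mulV fps_unitPl fps_inv_out.

Lemma fps_unitE f : (f \is a GRing.unit) = (f 0%N != 0).
Proof. by []. Qed.

Lemma fps_valuation f : f != 0 ->
  exists2 n, f n != 0 & forall i, (i < n)%N -> f i = 0.
Proof.
move=> nz; have ex : exists n, f n != 0.
  apply: contrapT => none; case/eqP: nz; apply/fpsP => n; rewrite fps0E.
  by apply/eqP; apply: contrapT => /negP nzn; apply: none; exists n.
case: (ex_minnP ex) => n nzn minn; exists n => // i ltin.
by apply/eqP; apply: contraLR ltin => /minn; rewrite -leqNgt.
Qed.

Lemma fps_idomain f g : f * g = 0 -> (f == 0) || (g == 0).
Proof.
move=> fg0; apply: contraT; rewrite negb_or.
case/andP=> /fps_valuation[m nzm zm] /fps_valuation[n nzn zn].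
move/fpsP/(_ (m + n)%N)/eqP: fg0; rewrite fps0E fpsME.
have ltm : (m < (m + n).+1)%N by rewrite ltnS leq_addr.
rewrite (bigD1 (Ordinal ltm)) //= addKn big1 => [|i].
  by rewrite addr0 mulf_eq0 (negPf nzm) (negPf nzn).
rewrite -val_eqE /= neq_ltn => /orP[/zm-> | ltmi]; first by rewrite mul0r.
rewrite zn ?mulr0 // -(ltn_add2r i) subnK; last by rewrite -ltnS.
by rewrite [(n + i)%N]addnC ltn_add2r.
Qed.

HB.instance Definition _ :=
  GRing.ComUnitRing_isIntegral.Build (fps K) fps_idomain.

(* The square root with constant term 1 (meaningful when [a 0 = 1]): solve    *)
(* [2 s_n + \sum_(0 < i < n) s_i s_(n - i) = a_n] for s_n.                    *)
Definition fps_sqrt_step a (t : seq K) : K :=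
  if size t is n.+1 then
    (a n.+1 - \sum_(1 <= i < n.+1) t`_i * t`_(n.+1 - i)) / 2%:R
  else 1.
Definition fps_sqrt a : fps K := fps_rec (fps_sqrt_step a).

Lemma fps_sqrt0 a : fps_sqrt a 0%N = 1.
Proof. by []. Qed.

Lemma fps_sqrtS a n (s := fps_sqrt a) :
  s n.+1 = (a n.+1 - \sum_(1 <= i < n.+1) s i * s (n.+1 - i)%N) / 2%:R.
Proof.
rewrite -[LHS]/(fps_sqrt_step a (fps_prefix _ n.+1)) {1}/fps_sqrt_step.
rewrite size_fps_prefix; congr ((_ - _) / _).
apply: eq_big_nat => i /andP[gt0i ltin]; rewrite !nth_fps_prefix //.
by rewrite ltn_subrL gt0i.
Qed.

Lemma sqr_fps_sqrt a : (2%:R : K) != 0 -> a 0%N = 1 -> fps_sqrt a ^+ 2 = a.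
Proof.
move=> nz2 a0; move: (fps_sqrt a) (fps_sqrt0 a) (fps_sqrtS a) => s s0 sS.
apply/fpsP => -[|n]; first by rewrite expr2 fpsM0 s0 mulr1 a0.
rewrite expr2 fpsME -(big_mkord xpredT (fun i => s i * s (n.+1 - i)%N)).
rewrite big_ltn // big_nat_recr //= subnn subn0 s0 mul1r mulr1.
rewrite addrCA -mulr2n -mulr_natr sS divfK //.
by rewrite addrC subrK.
Qed.

Lemma fps_sqrt_uniq a s : (2%:R : K) != 0 ->
  s 0%N = 1 -> s ^+ 2 = a -> s = fps_sqrt a.
Proof.
move=> nz2 s0 s2; have a0 : a 0%N = 1 by rewrite -s2 expr2 fpsM0 s0 mulr1.
have /eqP := sqr_fps_sqrt nz2 a0; rewrite -s2 eqf_sqr => /orP[/eqP-> //|].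
move=> /eqP/fpsP/(_ 0%N)/eqP; rewrite s2 fps_sqrt0 fpsNE s0 -subr_eq0 opprK.
by rewrite -mulr2n (negPf nz2).
Qed.

End Fps.

(* Lattice paths, given by their sequence of steps from (0,0).                *)

Inductive step := U | D | H.

Definition step_code (s : step) : 'I_3 :=
  match s with U => inord 0 | D => inord 1 | H => inord 2 end.
Definition step_decode (i : 'I_3) : step :=
  match val i with 0%N => U | 1%N => D | _ => H end.
Lemma step_codeK : cancel step_code step_decode.
Proof. by case; rewrite /step_decode /= inordK. Qed.
HB.instance Definition _ := Equality.copy step (can_type step_codeK).
HB.instance Definition _ := Choice.copy step (can_type step_codeK).
HB.instance Definition _ := Countable.copy step (can_type step_codeK).
HB.instance Definition _ := Finite.copy step (can_type step_codeK).

Definition vec (s : step) : int * int :=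
  match s with U => (1, 1) | D => (1, -1) | H => (2, 0) end.

Definition vertex (P : seq step) (k : nat) : int * int :=
  \sum_(s <- take k P) vec s.

Definition schroder (n : nat) (P : seq step) : bool :=
  (vertex P (size P) == ((2 * n)%N%:Z, 0))
  && [forall k : 'I_(size P).+1, 0 <= (vertex P k).2].

Definition no_axis_H (P : seq step) : bool :=
  [forall k : 'I_(size P), (nth U P k == H) ==> ((vertex P k).2 != 0)].

Definition small_schroder (n : nat) (P : seq step) : bool :=
  [&& (0 < n)%N, schroder n P & no_axis_H P].

Definition dr (P : seq step) : nat :=
  count (fun st => (st.1 == st.2) && (st.1 != H)) (zip P (behead P)).
Definition hr (P : seq step) : nat :=
  count (fun st => (st.1 == H) && (st.2 == H)) (zip P (behead P)).

(* Hence the paths of order n are all found among the [(2 * n).-bseq step].   *)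
Lemma schroder_size n P : schroder n P -> (size P <= 2 * n)%N.
Proof.
case/andP=> /eqP eP _; have -> : (size P <= 2 * n)%N =
  ((size P)%:Z <= (vertex P (size P)).1) by rewrite eP.
rewrite /vertex take_size; elim: P {eP} => [|s P IHP]; first by rewrite big_nil.
rewrite big_cons /= intS lerD //; by case: s.
Qed.

Notation "p %:F" := (tofrac p) : ring_scope.

Definition Qyz : fieldType := {fraction {mpoly rat[2]}}.
Definition yQ : Qyz := ('X_ord0 : {mpoly rat[2]})%:F.
Definition zQ : Qyz := ('X_ord_max : {mpoly rat[2]})%:F.

Definition R_AS3 : fps Qyz :=
  1 + FPS (fun n => \sum_(P : (2 * n).-bseq step | small_schroder n P)
                      yQ ^+ dr P * zQ ^+ hr P).

(* The inverses, the square root and the quotient occurring in the closed     *)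
(* form of [R_AS3] are all genuine, i.e. never the default values of          *)
(* [_^-1] and [fps_sqrt].                                                     *)
Section WellDefined.
Local Notation x := (fpsX Qyz).
Local Notation y := (fpsC yQ).
Local Notation z := (fpsC zQ).

Lemma yQ_neq0 : yQ != 0.
Proof.
rewrite tofrac_eq0; apply/eqP => /(congr1 (meval (fun=> 1)))/eqP.
by rewrite mevalXU rmorph0 oner_eq0.
Qed.

Lemma Qyz_nat_neq0 n : (n.+1%:R : Qyz) != 0.
Proof.
have -> : (n.+1%:R : Qyz) = (n.+1%:R : {mpoly rat[2]})%:F by rewrite rmorph_nat.
rewrite tofrac_eq0; apply/eqP => /(congr1 (meval (fun=> 0)))/eqP.
by rewrite rmorph_nat rmorph0 pnatr_eq0.
Qed.

Lemma unit_1Mxz : 1 - x * z \is a GRing.unit.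
Proof. by rewrite fps_unitE fpsDE fpsNE fpsM0 /= mul0r subr0 oner_eq0. Qed.

Lemma unit_xDy : x + y * (1 - x * z) \is a GRing.unit.
Proof.
rewrite fps_unitE fpsDE fpsM0 fpsDE fpsNE fpsM0 /= mul0r subr0 mulr1 add0r.
exact: yQ_neq0.
Qed.

Lemma radicand0 (v w : fps Qyz) (u := x * v) :
  (1 - 2%:R * (1 + w) * u + (1 - w) ^+ 2 * u ^+ 2) 0%N = 1.
Proof.
have u0 : u 0%N = 0 by rewrite fpsM0 /= mul0r.
clearbody u; rewrite [u ^+ 2]expr2 !fpsDE !fpsNE !fpsM0 u0 !mulr0.
by rewrite subr0 addr0.
Qed.

Lemma denominator_neq0 :
  2%:R * (y ^+ 2 * z - 2%:R * y + 1) * x ^+ 2 - 2%:R * y ^+ 2 * x - 2%:R * x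
  != 0.
Proof.
have MX f : (f * x) 1%N = f 0%N.
  by rewrite fpsME !big_ord_recl big_ord0 /= mulr0 !addr0 mulr1.
apply/eqP => /fpsP/(_ 1%N)/eqP; apply/negP.
rewrite fps0E !expr2 !mulrA !fpsDE !fpsNE !MX !fpsM0 mulr0 sub0r.
rewrite (_ : (2%:R : fps Qyz) 0%N = 2%:R) // -opprD oppr_eq0 /=.
rewrite -mulrA -[X in _ + X]mulr1 -mulrDr mulf_eq0 negb_or (Qyz_nat_neq0 1) /=.
have -> : yQ * yQ + 1 = ('X_ord0 * 'X_ord0 + 1 : {mpoly rat[2]})%:F.
  by rewrite rmorphD rmorphM rmorph1.
rewrite tofrac_eq0; apply/eqP => /(congr1 (meval (fun=> 0)))/eqP.
by rewrite !(rmorphD, rmorphM, rmorph1, rmorph0) /= mevalXU mulr0 add0r oner_eq0.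
Qed.
End WellDefined.

(* Main.v *)
(* Weight a path by giving each [U] and [H] a factor [x] (so that [order] is   *)
(* the exponent of [x]) and each pair of consecutive steps its run weight. The *)
(* series [f_s] of the first passages from one level to the level just below,  *)
(* after a previous step [s], satisfy                                          *)
(*   f_s = wt s D + x (wt s U) f_U f_D + x (wt s H) f_H,                       *)
(* and a small path is a sequence of elevated ones, so [R = 1 / (1 - x f_U)].  *)
(* Eliminating [f_D] and [f_H] gives a quadratic equation for [e = x f_U]:     *)
(*   m e^2 - (1 + x m^2 - x g^2) e + x m = 0,                                  *)
(* where [m = 1 + x / (1 - x z)] and [g = y + x / (1 - x z)], whose            *)
(* discriminant is the radicand of the theorem. Conversely, the root [e] with  *)
(* zero constant term provides series [f_s] solving the system, and the system *)
(* determines the coefficients counting the paths, by induction on length.     *)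

Require Import Defs.
From mathcomp Require Import all_boot all_order all_algebra.
From mathcomp Require Import mpoly.
From mathcomp Require Import ring zify.
Import GRing.Theory.
Local Open Scope ring_scope.

(** Run weights factor over consecutive pairs of steps, so the weighted sum over the suffixes that
    follow a given step obeys a one-step recursion ([suffix_sumS]). Any solution of the
    first-passage system yields products of series with the same recursion, whence [suffix_sumE].
    The system therefore needs no combinatorial derivation: a solution is built algebraically from
    the root [e] ([first_passage_eq]), the counting series is [1 / (1 - e)], and [u = x g^2],
    [w u = x m^2] turn the quadratic into the closed form ([small_schroder_series_eq]). *)

Lemma fpsXME (K : fieldType) (f : fps K) n :
  (fpsX K * f) n = if n is n'.+1 then f n' else 0.
Proof.
rewrite fpsME; case: n => [|n]; first by rewrite big_ord1 mul0r.
rewrite 2!big_ord_recl big1 => [|i _] /=; last by rewrite mul0r.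
by rewrite mul0r mul1r add0r addr0 subn1.
Qed.

Lemma fpsCME (K : fieldType) c (f : fps K) n : (fpsC c * f) n = c * f n.
Proof.
by rewrite fpsME big_ord_recl big1 => [|i _] /=; rewrite ?mul0r // addr0 subn0.
Qed.

(** * Sums over words of bounded length, unfolded along the first letter *)

Fixpoint words (T : Type) (ts : seq T) (N : nat) : seq (seq T) :=
  if N is N'.+1 then [::] :: [seq t :: P | t <- ts, P <- words T ts N']
  else [:: [::]].

Lemma mem_words (T : finType) N (P : seq T) :
  (P \in words T (enum T) N) = (size P <= N)%N.
Proof.
elim: N P => [|N IHN] [|t P] //=; rewrite inE /= ltnS -IHN.
apply/allpairsP/idP => [[[t' Q] /= [_ PN [_ ->]]] // | PN].
by exists (t, P); rewrite mem_enum.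
Qed.

Lemma words_uniq (T : finType) N : uniq (words T (enum T) N).
Proof.
elim: N => //= N IHN; apply/andP; split; first by apply/allpairsP => -[[]] ? ? [].
by apply: allpairs_uniq; rewrite ?enum_uniq // => -[t P] [t' P'] _ _ [-> ->].
Qed.

Lemma big_bseq_words (T : finType) (R : nmodType) N (p : pred (seq T))
    (F : seq T -> R) :
  \sum_(P : N.-bseq T | p P) F P = \sum_(P <- words T (enum T) N | p P) F P.
Proof.
rewrite -(big_map val p F); apply/perm_big/uniq_perm; last 1 first.
- move=> P; rewrite mem_words; apply/mapP/idP => [[Q _ ->] | PN].
    exact: size_bseq.
  by exists (Bseq PN); rewrite ?mem_index_enum.
- by rewrite map_inj_uniq ?index_enum_uniq //; exact: val_inj.
- exact: words_uniq.
Qed.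

Lemma step_eqE :
  ((U == D) = false) * ((U == H) = false) * ((D == U) = false)
  * ((D == H) = false) * ((H == U) = false) * ((H == D) = false).
Proof. by do ![split]; apply/eqP. Qed.

Lemma big_words_step (R : nmodType) N (p : pred (seq step)) (F : seq step -> R) :
  let W := words step (enum {: step}) in
  \sum_(P <- W N.+1 | p P) F P
    = (if p [::] then F [::] else 0)
      + \sum_(P <- W N | p (U :: P)) F (U :: P)
      + \sum_(P <- W N | p (D :: P)) F (D :: P)
      + \sum_(P <- W N | p (H :: P)) F (H :: P).
Proof.
move=> W; have perm_steps : perm_eq (enum {: step}) [:: U; D; H].
  apply: uniq_perm; rewrite ?enum_uniq //= ?inE ?step_eqE //.
  by move=> s; rewrite mem_enum !inE; case: s; rewrite !eqxx ?orbT.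
rewrite big_mkcond /= big_cons big_allpairs_dep /= (perm_big _ perm_steps) /=.
by rewrite !big_cons big_nil addr0 !addrA -!big_mkcond.
Qed.

(** * Small Schröder paths as words accepted step by step *)

(* [P] leads from height [h] to height 0 and has [n] non-down steps.           *)
Fixpoint small_suffix (h n : nat) (P : seq step) : bool :=
  match P with
  | [::] => (h == 0%N) && (n == 0%N)
  | U :: P' => (0 < n)%N && small_suffix h.+1 n.-1 P'
  | D :: P' => (0 < h)%N && small_suffix h.-1 n P'
  | H :: P' => [&& (0 < h)%N, (0 < n)%N & small_suffix h n.-1 P']
  end.

Lemma vertex0 P : vertex P 0 = 0.
Proof. by rewrite /vertex take0 big_nil. Qed.

Lemma vertexS s P k : vertex (s :: P) k.+1 = vec s + vertex P k.
Proof. by rewrite /vertex /= big_cons. Qed.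

(** [U] and [H] raise the sum of the coordinates by 2, and [D] preserves it. A suffix starting with
    a non-down step thus has [n > 0]. *)
Lemma vertex_cone P k : (0 <= (vertex P k).1 + (vertex P k).2)%R.
Proof.
elim: P k => [|s P IHP] [|k]; rewrite ?vertex0 // /vertex ?big_nil //.
by rewrite -/(vertex _ _) vertexS /=; have := IHP k; case: s => /=; lia.
Qed.

(** The suffix is translated to start at the origin, so heights are shifted by [h]. *)
Definition small_suffix_spec (h n : nat) (P : seq step) : Prop :=
  [/\ vertex P (size P) = ((2 * n + h)%N%:Z, - h%:Z),
      forall k, (k <= size P)%N -> (0 <= h%:Z + (vertex P k).2)%R
    & forall k, (k < size P)%N -> nth U P k = H -> h%:Z + (vertex P k).2 != 0].

Lemma small_suffix_spec_cons (h n h' n' : nat) s P :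
    h'%:Z = h%:Z + (vec s).2 ->
    (2 * n + h)%N%:Z = (vec s).1 + (2 * n' + h')%N%:Z ->
    (s = H -> h != 0%N) ->
  small_suffix_spec h' n' P <-> small_suffix_spec h n (s :: P).
Proof.
move=> eh en sH; split=> -[eP geP neP].
  split=> [|[|k] lek|[|k] ltk].
  - by rewrite vertexS eP [LHS]surjective_pairing /=; congr (_, _); lia.
  - by rewrite vertex0 /=; lia.
  - by rewrite vertexS /= addrA -eh; exact: geP.
  - by rewrite vertex0 /= => /sH; lia.
  - by rewrite vertexS /= addrA -eh; exact: neP.
split=> [|k lek|k ltk nk].
- move: eP; rewrite vertexS; case: (vertex P _) => a b.
  by case: (vec s) eh en => c d /= eh en [] ea eb; congr (_, _); lia.
- by rewrite eh -addrA; have := geP k.+1 lek; rewrite vertexS.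
- by rewrite eh -addrA; have := neP k.+1 ltk nk; rewrite vertexS.
Qed.

Lemma small_suffixP (h n : nat) P :
  reflect (small_suffix_spec h n P) (small_suffix h n P).
Proof.
elim: P h n => [|s P IHP] h n.
  apply: (iffP andP) => [[/eqP-> /eqP->] | [+ _ _]].
    by split=> [|k _|//]; rewrite ?vertex0 // /vertex big_nil.
  by rewrite vertex0 => -[e1 e2]; split; lia.
have n_gt0 : s <> D -> small_suffix_spec h n (s :: P) -> (0 < n)%N.
  move=> sD [+ _ _]; rewrite vertexS; have := vertex_cone P (size P).
  by case: (vertex P _) => a b; case: s sD => //= _ ge0 [] e1 e2; lia.
have h_gt0 : s <> U -> small_suffix_spec h n (s :: P) -> (0 < h)%N.
  move=> sU [_ geP neP]; have := geP 1%N isT; have := neP 0%N isT.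
  rewrite vertexS !vertex0 /=; case: s {n_gt0 geP neP} sU => //= _; first by lia.
  by move/(_ erefl); lia.
case: s n_gt0 h_gt0 => n_gt0 h_gt0 /=.
- have [n0 | n0] := ltnP 0 n; last by constructor => /(n_gt0 ltac:(done)); lia.
  by apply: (equivP (IHP _ _)); apply: small_suffix_spec_cons => //=; lia.
- have [h0 | h0] := ltnP 0 h; last by constructor => /(h_gt0 ltac:(done)); lia.
  by apply: (equivP (IHP _ _)); apply: small_suffix_spec_cons => //=; lia.
have [h0 | h0] := ltnP 0 h; last by constructor => /(h_gt0 ltac:(done)); lia.
have [n0 | n0] := ltnP 0 n; last by constructor => /(n_gt0 ltac:(done)); lia.
by apply: (equivP (IHP _ _)); apply: small_suffix_spec_cons => //=; lia.
Qed.

Lemma small_schroderE n P :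
  small_schroder n P = (0 < n)%N && small_suffix 0 n P.
Proof.
rewrite /small_schroder /schroder /no_axis_H; congr (_ && _).
apply/andP/small_suffixP => [[/andP[/eqP eP /forallP geP] /forallP neP] | []].
  split=> [|k lek|k ltk nk]; first by rewrite eP addn0 oppr0.
    by rewrite add0r; exact: geP (Ordinal (lek : k < (size P).+1)%N).
  by rewrite add0r; move: (neP (Ordinal ltk)); rewrite /= nk eqxx.
rewrite addn0 oppr0 => -> geP neP; split; first rewrite eqxx /=.
  by apply/forallP => k; have := geP k (ltn_ord k); rewrite add0r.
apply/forallP => k; apply/implyP => /eqP nk.
by have := neP k (ltn_ord k) nk; rewrite add0r.
Qed.

(** * Weighted counting of suffixes *)

Section RunWeights.
Variables (K : fieldType) (y z : K).

Definition run_weight (s t : step) : K :=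
  if s != t then 1 else if s == H then z else y.

Lemma run_weight_cons s t P :
  y ^+ dr (s :: t :: P) * z ^+ hr (s :: t :: P)
  = run_weight s t * (y ^+ dr (t :: P) * z ^+ hr (t :: P)).
Proof.
rewrite /dr /hr /run_weight /= !exprD.
by case: s; case: t; rewrite /= ?eqxx ?step_eqE /= ?add0n ?add1n ?expr0 ?expr1; ring.
Qed.

(** [s] is the step just before the suffix, so that the run at the junction is counted. *)
Definition suffix_sum (N h n : nat) (s : step) : K :=
  \sum_(P <- words step (enum {: step}) N | small_suffix h n P)
     y ^+ dr (s :: P) * z ^+ hr (s :: P).

Lemma suffix_sumS N h n s :
  suffix_sum N.+1 h n s
  = ((h == 0%N) && (n == 0%N))%:R
    + (if (0 < n)%N then run_weight s U * suffix_sum N h.+1 n.-1 U else 0)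
    + (if (0 < h)%N then run_weight s D * suffix_sum N h.-1 n D else 0)
    + (if (0 < h)%N && (0 < n)%N
       then run_weight s H * suffix_sum N h n.-1 H else 0).
Proof.
have pull t (b : bool) (p : pred (seq step)) :
    \sum_(P <- words step (enum {: step}) N | b && p P)
      y ^+ dr (s :: t :: P) * z ^+ hr (s :: t :: P)
    = if b then run_weight s t * \sum_(P <- words step (enum {: step}) N | p P)
      y ^+ dr (t :: P) * z ^+ hr (t :: P) else 0.
  case: b => /=; last by rewrite big_pred0.
  by rewrite mulr_sumr; apply: eq_bigr => P _; rewrite run_weight_cons.
rewrite /suffix_sum big_words_step -!pull.
congr (_ + _ + _ + _).
- by rewrite [X in if X then _ else _]/=; case: ifP => // _; rewrite mul1r.
- by apply: eq_bigl => P /=; rewrite andbA.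
Qed.

Local Notation X := (fpsX K).
Local Notation wt s t := (fpsC (run_weight s t)).

Section System.
Variables (f : step -> fps K) (R : fps K).
Hypothesis f_eq : forall s,
  f s = wt s D + X * (wt s U * (f U * f D)) + X * (wt s H * f H).
Hypothesis R_eq : R = 1 + X * (f U * R).

(** The descent to the axis is cut at its first passages; each one after the first is preceded by
    [D]. On the axis only [U] may follow, hence the separate case. *)
Definition suffix_series (h : nat) (s : step) : fps K :=
  if h is h'.+1 then f s * f D ^+ h' * R else 1 + X * (wt s U * (f U * R)).

Lemma suffix_series0D : suffix_series 0 D = R.
Proof. by rewrite /suffix_series /run_weight step_eqE /= rmorph1 mul1r -R_eq. Qed.

Lemma suffix_seriesD h : suffix_series h D = f D ^+ h * R.
Proof. by case: h => [|h]; rewrite ?suffix_series0D ?mul1r //= exprS. Qed.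

Lemma suffix_series0 s :
  suffix_series 0 s = 1 + X * (wt s U * suffix_series 1 U).
Proof. by rewrite /= mulr1. Qed.

Lemma suffix_seriesS h s :
  suffix_series h.+1 s
  = X * (wt s U * suffix_series h.+2 U) + wt s D * suffix_series h D
    + X * (wt s H * suffix_series h.+1 H).
Proof. by rewrite suffix_seriesD /= {1}(f_eq s) exprS; ring. Qed.

(** Such a suffix has at most [n] up steps, hence at most [2 * n + h] steps: the bound [N] loses no
    path, and it decreases along the common recursion. *)
Lemma suffix_sumE N h n s :
  (2 * n + h <= N)%N -> suffix_sum N h n s = suffix_series h s n.
Proof.
elim: N h n s => [|N IHN] h n s leN.
  have [-> ->] : h = 0%N /\ n = 0%N by lia.
  rewrite /suffix_series fpsDE fpsXME fps1E addr0.
  by rewrite /suffix_sum big_cons big_nil /dr /hr /= mulr1 addr0.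
rewrite suffix_sumS; case: h leN => [|h] leN.
  rewrite suffix_series0 fpsDE fpsXME fps1E !addr0.
  by case: n leN => [|n] leN //; rewrite fpsCME IHN //; lia.
rewrite suffix_seriesS !fpsDE !fpsXME fpsCME add0r.
by case: n leN => [|n] leN; rewrite ?fpsCME [LHS]/= !IHN ?addr0 ?add0r //; lia.
Qed.

Lemma small_schroder_sum n : (0 < n)%N ->
  \sum_(P : (2 * n).-bseq step | small_schroder n P) y ^+ dr P * z ^+ hr P
  = R n.
Proof.
move=> n0; rewrite -suffix_series0D -(@suffix_sumE (2 * n)) ?addn0 //.
rewrite (big_bseq_words _ _ _ (small_schroder n)
  (fun P => y ^+ dr P * z ^+ hr P)).
apply: eq_big => P; first by rewrite small_schroderE n0.
(* A nonempty small path starts with [U], so a fictitious [D] before it creates no run. *)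
rewrite small_schroderE => /andP[_]; case: P => [|[] P] // _.
by rewrite run_weight_cons /run_weight step_eqE mul1r.
Qed.

End System.

Local Notation Y := (fpsC y).
Local Notation Z := (fpsC z).

(** * Solving the first-passage system *)

Section Elimination.
Variables v e k : fps K.
Local Notation a := (1 - X * Z).
Local Notation m := (1 + X * v).
Local Notation g := (Y + X * v).
Local Notation B := (1 + X * m ^+ 2 - X * g ^+ 2).
Hypothesis v_eq : v * a = 1.
Hypothesis k_eq : k * (1 - m * e) = 1.
Hypothesis e_eq : m * e ^+ 2 - B * e + X * m = 0.

(** With [e] for [x f_U], the system gives [f_H = v (1 + e f_D)] and [f_D = g + m e f_D], so
    [f_D = g k]. *)
Definition first_passage (s : step) : fps K :=
  match s with
  | U => 1 + Y * (e * (g * k)) + X * (v * (1 + e * (g * k)))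
  | D => g * k
  | H => v * (1 + e * (g * k))
  end.

(** Consistency of the choice of [e]: cleared of [1 - m e], this is the quadratic. *)
Lemma X_first_passage_U : X * first_passage U = e.
Proof.
apply/eqP; rewrite -subr_eq0; apply/eqP; transitivity
    (k * (m * e ^+ 2 - B * e + X * m) + (1 - k * (1 - m * e)) * (X * m - e)).
  by rewrite /=; ring.
by rewrite e_eq k_eq subrr mulr0 mul0r addr0.
Qed.

Lemma first_passage_eq s :
  first_passage s
  = wt s D + X * (wt s U * (first_passage U * first_passage D))
      + X * (wt s H * first_passage H).
Proof.
have -> : X * (wt s U * (first_passage U * first_passage D))
          = wt s U * (e * first_passage D).
  by rewrite -[in RHS]X_first_passage_U; ring.
apply/eqP; rewrite -subr_eq0; apply/eqP.
case: s; rewrite /run_weight ?eqxx ?step_eqE /= ?rmorph1; first by ring.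
  transitivity (g * (k * (1 - m * e) - 1)); first by ring.
  by rewrite k_eq subrr mulr0.
transitivity ((1 + e * (g * k)) * (v * a - 1)); first by ring.
by rewrite v_eq subrr mulr0.
Qed.

End Elimination.

(** Denominators are cleared because [D] has no constant term, hence no inverse among power
    series. *)
Lemma small_schroder_series_eq :
  let u := X * ((X + Y * (1 - X * Z)) / (1 - X * Z)) ^+ 2 in
  let w := ((1 - X * Z + X) / (X + Y * (1 - X * Z))) ^+ 2 in
  let R := 1 + FPS (fun n => \sum_(P : (2 * n).-bseq step | small_schroder n P)
                               y ^+ dr P * z ^+ hr P) in
  let N := - 1 + Z * X + (1 - Z) * X ^+ 2
           + (1 - X * Z)
             * fps_sqrt (1 - 2 * (1 + w) * u + (1 - w) ^+ 2 * u ^+ 2) in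
  let D := 2 * (Y ^+ 2 * Z - 2 * Y + 1) * X ^+ 2 - 2 * Y ^+ 2 * X - 2 * X in
  (2 : K) != 0 -> y != 0 -> 2 * D * R = D + 2 * N.
Proof.
move=> u w R N D nz2 nz_y.
have X0 : X 0%N = 0 by [].
have coef0 := (expr2, fpsDE, fpsNE, fpsM0, fps1E, X0, mul0r, subr0, addr0, mulr1).
pose a := 1 - X * Z; pose v := a^-1.
have ua : a \is a GRing.unit by rewrite fps_unitE !coef0 oner_eq0.
have va : v * a = 1 by rewrite mulVr.
pose m := 1 + X * v; pose g := Y + X * v; pose B := 1 + X * m ^+ 2 - X * g ^+ 2.
have um : m \is a GRing.unit by rewrite fps_unitE !coef0 oner_eq0.
have ug : g \is a GRing.unit by rewrite fps_unitE !coef0.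
have u2 : (2 : fps K) \is a GRing.unit by rewrite fps_unitE.
have ag : X + Y * a = a * g.
  by rewrite -[X in X + _]mulr1 -va /g; ring.
have am : a + X = a * m by rewrite -[X in _ + X]mulr1 -va /m; ring.
have uE : u = X * g ^+ 2 by rewrite /u -/a ag [a * g]mulrC mulrK.
have wE : w * g ^+ 2 = m ^+ 2.
  by rewrite /w -/a ag am -exprMn invrM // mulrA mulrAC mulrVK // [a * m]mulrC mulrK.
have wuE : w * u = X * m ^+ 2 by rewrite uE mulrCA wE.
pose rad := 1 - 2 * (1 + w) * u + (1 - w) ^+ 2 * u ^+ 2.
have radE : rad = B ^+ 2 - 2 * 2 * X * m ^+ 2.
  rewrite (_ : rad = (1 + w * u - u) ^+ 2 - 2 * 2 * (w * u)) /rad; last by ring.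
  by rewrite wuE uE -!mulrA.
pose s := fps_sqrt rad.
have s2 : s ^+ 2 = B ^+ 2 - 2 * 2 * X * m ^+ 2.
  by rewrite -radE sqr_fps_sqrt // radE !(coef0, mulr0).
(* [B] and [s] both have constant term 1, so this is the root with zero constant term, which makes
   [1 - e] and [1 - m * e] invertible. *)
pose e := (B - s) / (2 * m).
have uu : 2 * m \is a GRing.unit by rewrite unitrM u2.
have sE : s = B - 2 * m * e by rewrite mulrC divrK // subKr.
have e0 : e 0%N = 0 by rewrite fpsM0 !coef0 fps_sqrt0 subrr mul0r.
clearbody e; have e_eq : m * e ^+ 2 - B * e + X * m = 0.
  apply: (mulrI (_ : 2 * (2 * m) \is a GRing.unit)); first by rewrite unitrM u2.
  transitivity (s ^+ 2 - B ^+ 2 + 2 * 2 * X * m ^+ 2); first by rewrite sE; ring.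
  by rewrite s2 mulr0; ring.
have u1me : 1 - m * e \is a GRing.unit.
  by rewrite fps_unitE !coef0 e0 mulr0 subr0 oner_eq0.
have u1e : 1 - e \is a GRing.unit by rewrite fps_unitE !coef0 e0 subr0 oner_eq0.
have k_eq : (1 - m * e)^-1 * (1 - m * e) = 1 by rewrite mulVr.
have R_eq : (1 - e)^-1 = 1 + X * (first_passage v e (1 - m * e)^-1 U * (1 - e)^-1).
  rewrite mulrA (X_first_passage_U _ _ _ k_eq e_eq).
  by apply: (mulIr u1e); rewrite mulrDl mulVr // -mulrA mulVr //; ring.
have RE : R = (1 - e)^-1.
  apply/fpsP => -[|n].
    (* At order 0 the sum is empty; the constant 1 stands for the empty path. *)
    by rewrite R_eq !fpsDE fpsXME /= big_pred0.
  rewrite fpsDE fps1E add0r.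
  by rewrite -(small_schroder_sum _ _ (first_passage_eq _ _ _ va k_eq e_eq) R_eq).
have DE : D = - (2 * a * (m * (1 + X) - B)).
  apply/eqP; rewrite -subr_eq0; apply/eqP.
  (* The identity holds only modulo [v * a = 1]; this is the explicit multiple of [v * a - 1]. *)
  transitivity (2 * (v * a - 1) * (X * (1 + X) - 2 * X ^+ 2 * (1 - Y))).
    by rewrite /D /B /m /g /a; ring.
  by rewrite va subrr mulr0 mul0r.
have NE : N = a * (B - 2 * m * e) - a * m * (1 - X).
  apply/eqP; rewrite -subr_eq0; apply/eqP.
  transitivity ((v * a - 1) * X * (1 - X)).
    by rewrite /N -/rad -/s -/a sE /m /a; ring.
  by rewrite va subrr !mul0r.
apply: (mulIr u1e); rewrite RE -[LHS]mulrA mulVr // mulr1.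
apply/eqP; rewrite eq_sym -subr_eq0; apply/eqP.
transitivity (2 * 2 * a * (m * e ^+ 2 - B * e + X * m)).
  by rewrite DE NE; ring.
by rewrite e_eq mulr0.
Qed.

End RunWeights.

Lemma half_add_div (F : fieldType) (r d n : F) :
  (2 : F) != 0 -> d != 0 -> 2 * d * r = d + 2 * n -> r = 1 / 2 + n / d.
Proof.
move=> nz2 nzd r_eq; apply: (mulfI (mulf_neq0 nz2 nzd)); rewrite r_eq.
by field; rewrite nzd nz2.
Qed.

Theorem theorem3p2 :
  let x := fpsX Qyz in
  let y := fpsC yQ in
  let z := fpsC zQ in
  let u := x * ((x + y * (1 - x * z)) / (1 - x * z)) ^+ 2 in
  let w := ((1 - x * z + x) / (x + y * (1 - x * z))) ^+ 2 in
  R_AS3%:F =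
    1 / 2
    + (- 1 + z * x + (1 - z) * x ^+ 2
       + (1 - x * z)
         * fps_sqrt (1 - 2 * (1 + w) * u + (1 - w) ^+ 2 * u ^+ 2))%:F
      / (2 * (y ^+ 2 * z - 2 * y + 1) * x ^+ 2 - 2 * y ^+ 2 * x - 2 * x)%:F.
Proof.
move=> x y z u w.
have R_eq := small_schroder_series_eq _ yQ zQ (Qyz_nat_neq0 1) yQ_neq0.
rewrite -/R_AS3 -/x -/y -/z -/u -/w in R_eq.
have nzD : (2 * (y ^+ 2 * z - 2 * y + 1) * x ^+ 2 - 2 * y ^+ 2 * x - 2 * x)%:F != 0.
  by rewrite tofrac_eq0 denominator_neq0.
have nz2 : (2 : {fraction fps Qyz}) != 0.
  rewrite -(rmorph_nat (tofrac (R := fps Qyz))) tofrac_eq0.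
  by apply/eqP => /fpsP/(_ 0%N)/eqP; apply/negP; rewrite fps0E; exact: Qyz_nat_neq0 1.
move/(congr1 (fun f => f%:F)): R_eq nzD; rewrite tofracD !tofracM rmorph_nat.
move: (R_AS3%:F) (_ - 2 * x)%:F (_ + (1 - _) * fps_sqrt _)%:F => r d n R_eq nzD.
exact: (half_add_div _ _ _ _ nz2 nzD R_eq).
Qed.
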